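(* Let $G$ be a finite simple graph and $\theta$ a real number. Then $$\mathrm{mult}(\theta,G)=\max_{X\subseteq V(G)}\bigl(c_{\theta}(G\setminus X)-|X|\bigr).$$
   Context: All graphs are finite and simple. An $r$-matching in a graph $G$ is a set of $r$ edges, no two of which share a vertex; $p(G,r)$ is the number of $r$-matchings in $G$, with $p(G,0)=1$. For $G$ with $n$ vertices the matching polynomial is $\mu(G,x)=\sum_{r=0}^{\lfloor n/2\rfloor}(-1)^r p(G,r)x^{n-2r}$ (so it equals $1$ for the graph with no vertices). For a real number $\theta$, $\mathrm{mult}(\theta,G)$ is the multiplicity of $\theta$ as a root of $\mu(G,x)$ ($0$ if $\theta$ is not a root). $G\setminus X$ is the graph obtained from $G$ by deleting the vertices in $X$ and all incident edges; $G\setminus u=G\setminus\{u\}$. A vertex $u$ of $G$ is $\theta$-essential if $\mathrm{mult}(\theta,G\setminus u)=\mathrm{mult}(\theta,G)-1$. A graph is $\theta$-critical if all its vertices are $\theta$-essential and the multiplicity of $\theta$ as a root of its matching polynomial is $1$. ''Component'' means connected component, and $c_\theta(G)$ is the number of $\theta$-critical components of $G$. *)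

(* Defs.v *)
From mathcomp Require Import all_boot all_order all_algebra.
From mathcomp Require Import reals.

Set Implicit Arguments.
Unset Strict Implicit.
Unset Printing Implicit Defensive.

Import Order.TTheory GRing.Theory Num.Theory.
Local Open Scope ring_scope.

Record sgraph : Type := SGraph {
  vertex :> finType;
  adj : rel vertex;
  adj_sym : symmetric adj;
  adj_irrefl : irreflexive adj
}.

Section Induced.
Variables (G : sgraph) (S : {set G}).

Definition induced_adj : rel {x : G | x \in S} :=
  fun x y => adj (val x) (val y).

Lemma induced_adj_sym : symmetric induced_adj.
Proof. by move=> x y; apply: adj_sym. Qed.

Lemma induced_adj_irrefl : irreflexive induced_adj.
Proof. by move=> x; apply: adj_irrefl. Qed.

Definition induced : sgraph := SGraph induced_adj_sym induced_adj_irrefl.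

End Induced.

Definition del (G : sgraph) (X : {set G}) : sgraph := induced (~: X).

Definition edges (G : sgraph) : {set {set G}} :=
  [set [set xy.1; xy.2] | xy : G * G & adj xy.1 xy.2].

Definition matchings (G : sgraph) (r : nat) : {set {set {set G}}} :=
  [set M : {set {set G}} | [&& M \subset edges G, trivIset M & #|M| == r]].

Definition nb_matchings (G : sgraph) (r : nat) : nat := #|matchings G r|.

Definition components (G : sgraph) : {set {set G}} :=
  equivalence_partition (connect (@adj G)) [set: G].

Section MatchingPolynomial.
Variable R : realType.

Definition matching_poly (G : sgraph) : {poly R} :=
  \sum_(r < (#|G|./2).+1)
    ((-1) ^+ r * (nb_matchings G r)%:R) *: 'X^(#|G| - r.*2).

Definition mult (theta : R) (G : sgraph) : nat := mup theta (matching_poly G).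

(* The decrement appears as a successor on the left: subtraction on nat is
   truncated, so "mult theta G - 1" would also accept mult theta G = 0. *)
Definition essential (theta : R) (G : sgraph) (u : G) : bool :=
  (mult theta (del [set u])).+1 == mult theta G.

Definition critical (theta : R) (G : sgraph) : bool :=
  [forall u : G, essential theta u] && (mult theta G == 1%N).

Definition nb_critical_components (theta : R) (G : sgraph) : nat :=
  #|[set C in components G | critical theta (induced C)]|.

End MatchingPolynomial.

(* Main.v *)
Require Import Defs.
From mathcomp Require Import all_boot all_order all_algebra.
From mathcomp Require Import reals.
From mathcomp Require Import zify ring lra.

Set Implicit Arguments.
Unset Strict Implicit.
Unset Printing Implicit Defensive.

Import Order.TTheory GRing.Theory Num.Theory.
Local Open Scope ring_scope.

(** Write mu(S) for the matching polynomial of the subgraph induced by S, and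
    m(S) for the multiplicity of theta in it.  These multiplicities behave
    like the multiplicities of an eigenvalue of a symmetric matrix, and the
    reason is one inequality.  Give every vertex a real weight in place of the
    indeterminate; then, for distinct u and v,

      mu(S-u) mu(S-v) - mu(S) mu(S-u-v) >= [u ~ v] mu(S-u-v)^2      (rayleigh).

    Expanding mu(S) and mu(S-v) at u cancels the weight of u and turns the left
    side into [u ~ v] mu(S-u-v)^2 plus a sum of left sides for S-u, so that an
    induction on S proves it.

    Comparing the orders of vanishing at theta in such inequalities gives:
    - deleting a vertex changes m by at most one (mult_in_le_del,
      mult_in_del_le);
    - an essential vertex has no neutral neighbour (neutral_essential_nonadj),
      where u is neutral when m(S-u) = m(S);
    - call distinct essential vertices u, v parallel when m(S-u-v) >= m(S)-1.
      Adjacent essential vertices are parallel (adj_essential_parallel), and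
      being parallel is transitive (parallel_trans).  In the eigenvalue picture
      this says that the projections of the basis vectors u and v to the
      eigenspace are collinear.  Transitivity for a, b, c uses rayleigh for
      a, b with the weight of c tilted to x + lam (x - theta): the lowest
      coefficient of the left side is affine in lam, and it is nonconstant if a
      and c are not parallel.

    Together with the formula for the derivative of mu(S), which yields an
    essential vertex as soon as m(S) > 0, parallelism proves the analogue of
    Gallai's lemma (gallai): a connected graph all of whose vertices are
    essential has m = 1.

    For the theorem, mu is multiplicative over components, a critical component
    contributes one to m, and deleting X raises m by at most |X|; this is the
    upper bound.  For equality take X of maximal size with
    m(V - X) = m(V) + |X|.  In the graph that remains no deletion raises m, so
    a component with m > 0 contains an essential vertex, no neutral vertex
    next to an essential one, hence only essential vertices, and gallai makes
    it critical.  The remaining multiplicity then is the number of critical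
    components. *)

(** * Weighted matching polynomials and their recursion *)

Definition matching_in (G : sgraph) (S : {set G}) (M : {set {set G}}) :=
  [&& M \subset edges G, trivIset M & cover M \subset S].

(** The matching polynomial of the subgraph induced by S with an independent
    weight at each vertex; the constant weight 'X gives the usual one.  The
    separate weights are what parallel_trans perturbs. *)
Definition wmu (G : sgraph) (A : comNzRingType) (w : G -> A) (S : {set G}) :=
  \sum_(M | matching_in S M)
    (-1) ^+ #|M| * \prod_(v in S :\: cover M) w v.

Section Recursion.
Variables (G : sgraph).
Implicit Types (S : {set G}) (M : {set {set G}}).

Lemma edgesP (e : {set G}) :
  reflect (exists x y, adj x y /\ e = [set x; y]) (e \in edges G).
Proof.
apply: (iffP imsetP) => [[[x y] xy ->]|[x [y [xy ->]]]]; last first.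
  by exists (x, y); rewrite ?inE.
by rewrite inE in xy; exists x, y.
Qed.

Lemma edge_adj (u v : G) : [set u; v] \in edges G = adj u v.
Proof.
apply/idP/idP => [/edgesP [x [y [xy e]]]|uv]; last by apply/edgesP; exists u, v.
have xNy : x != y by apply: contraTneq xy => ->; rewrite adj_irrefl.
have /set2P xuv : x \in [set u; v] by rewrite e set21.
have /set2P yuv : y \in [set u; v] by rewrite e set22.
move: xuv yuv xy xNy => [->|->] [->|->] //; rewrite ?eqxx // => xy _.
by rewrite adj_sym.
Qed.

Lemma edge_at M u : M \subset edges G -> u \in cover M ->
  exists2 v, adj u v & [set u; v] \in M.
Proof.
move=> /subsetP Me /bigcupP [e eM ue].
have /edgesP [x [y [xy eE]]] := Me _ eM; move: ue eM; rewrite eE.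
by move=> /set2P [->|->] eM; [exists y|exists x; rewrite 1?adj_sym // setUC].
Qed.

Lemma matching_in_notin S M u :
  matching_in S M && (u \notin cover M) = matching_in (S :\ u) M.
Proof. by rewrite /matching_in subsetD1 -!andbA. Qed.

Lemma matching_in_edge S M u v : u \in S -> v \in S -> adj u v ->
  matching_in (S :\ u :\ v) M =
  [&& matching_in S ([set u; v] |: M) & [set u; v] \notin M].
Proof.
move=> uS vS uv; apply/idP/idP.
  rewrite -!matching_in_notin => /andP [/andP [/and3P [Me Mt Mc] uM] vM].
  have M0 : set0 \notin M.
    apply/negP => /(subsetP Me) /edgesP [x [y [_ /setP /(_ x)]]].
    by rewrite !inE eqxx.
  have dis B : B \in M -> [disjoint [set u; v] & B].
    move=> BM; apply/pred0P => z /=; apply/negP => /andP [/set2P zuv zB].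
    have : z \in cover M by apply/bigcupP; exists B.
    by case: zuv => ->; apply/negP.
  have [tU ->] := trivIsetU1 dis Mt M0.
  rewrite andbT /matching_in tU subUset sub1set edge_adj uv Me /=.
  apply/bigcupsP => B /setU1P [->|BM]; first by rewrite subUset !sub1set uS vS.
  by apply: subset_trans Mc; apply: bigcup_sup.
case/andP => /and3P [Me Mt Mc] eM; rewrite -!matching_in_notin.
have [sM eE] : M \subset [set u; v] |: M /\ [set u; v] \in [set u; v] |: M.
  by rewrite subsetUr setU11.
have nin z : z \in [set u; v] -> z \notin cover M.
  move=> ze; apply/negP => /bigcupP [B BM zB]; move: eM.
  suff -> : [set u; v] = B by rewrite BM.
  have [//|ne] := eqVneq [set u; v] B.
  have /pred0P/(_ z) := trivIsetP Mt _ _ eE (subsetP sM _ BM) ne.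
  by rewrite /= ze zB.
rewrite !nin ?set21 ?set22 // !andbT /matching_in (subset_trans sM Me).
rewrite (trivIsetS sM Mt) /=; apply/bigcupsP => B BM.
by apply: subset_trans Mc; apply/bigcup_sup/(subsetP sM).
Qed.

Lemma partner_unique M u v v' : trivIset M -> u != v -> u != v' ->
  [set u; v] \in M -> [set u; v'] \in M -> v = v'.
Proof.
move=> Mt uv uv' e e'.
have [eq|ne] := eqVneq [set u; v] [set u; v'].
  have : v \in [set u; v'] by rewrite -eq set22.
  by rewrite !inE => /orP [/eqP E|/eqP //]; rewrite E eqxx in uv.
by have /pred0P/(_ u) := trivIsetP Mt _ _ e e' ne; rewrite /= !set21.
Qed.

Lemma adj_neq (u v : G) : adj u v -> u != v.
Proof. by apply: contraTneq => ->; rewrite adj_irrefl. Qed.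

Variables (A : comNzRingType) (w : G -> A).

Lemma wmu0 : wmu w set0 = 1.
Proof.
rewrite /wmu (big_pred1 set0) => [|M].
  by rewrite cards0 mul1r set0D big_set0.
apply/idP/eqP => [/and3P [/subsetP Me _]|->].
  rewrite subset0 => /eqP c0; apply/eqP; rewrite -subset0; apply/subsetP => e eM.
  have /edgesP [x [y [_ eE]]] := Me _ eM.
  have : x \in cover M by apply/bigcupP; exists e; rewrite // eE set21.
  by rewrite c0 inE.
rewrite /matching_in sub0set /cover big_set0 sub0set andbT.
by apply/trivIsetP => B C; rewrite inE.
Qed.

(** Either u is unmatched, or a unique neighbour v is matched to it. *)
Lemma wmu_rec S u : u \in S ->
  wmu w S = w u * wmu w (S :\ u)
            - \sum_(v in S :\ u | adj u v) wmu w (S :\ u :\ v).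
Proof.
move=> uS; rewrite /wmu (bigID (fun M => u \notin cover M)) /=; congr (_ + _).
  rewrite big_distrr (eq_bigl _ _ (matching_in_notin S ^~ u)) /=.
  apply: eq_bigr => M; rewrite -matching_in_notin => /andP [_ uM].
  rewrite mulrCA (big_setD1 u) /= ?inE ?uM //; congr (_ * (_ * _)).
  by apply: eq_bigl => v; rewrite !inE andbCA.
pose F M := (-1) ^+ #|M| * \prod_(v in S :\: cover M) w v.
rewrite (eq_bigr (fun M => \sum_(v in S :\ u | adj u v && ([set u; v] \in M))
                              F M)); last first.
  move=> M /andP [/and3P [Me Mt Mc]]; rewrite negbK => uM.
  have [v uv vM] := edge_at Me uM.
  rewrite -/(F M) (big_pred1 v) // => v' /=; apply/idP/eqP => [/and3P [_ uv' v'M]|->].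
    by apply: (partner_unique Mt _ _ v'M vM); rewrite adj_neq.
  rewrite uv vM !inE eq_sym adj_neq //= andbT (subsetP Mc) //.
  by apply/bigcupP; exists [set u; v]; rewrite ?set22.
rewrite (exchange_big_dep (fun v => (v \in S :\ u) && adj u v)) /=; last first.
  by move=> M v _ /andP [-> /andP []].
rewrite -sumrN; apply: eq_bigr => v /andP [/setD1P [vNu vS] uv].
rewrite (eq_bigl (fun M => matching_in S M && ([set u; v] \in M))); last first.
  move=> M; rewrite !inE vNu vS uv /= -andbA; congr (_ && _).
  case: (boolP ([set u; v] \in M)) => [eM|]; rewrite ?andbF // !andbT negbK.
  by apply/bigcupP; exists [set u; v]; rewrite ?set21.
rewrite (reindex_onto (fun M => [set u; v] |: M) (fun M => M :\ [set u; v]))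
        /=; last by move=> M /andP [_ eM]; rewrite setD1K.
rewrite -sumrN; apply: eq_big => [M|M /andP [_ /eqP eM]].
  rewrite setU11 andbT matching_in_edge //; congr (_ && _).
  apply/eqP/idP => [<-|eM]; first by rewrite !inE eqxx.
  by rewrite setU1K.
have {}eM : [set u; v] \notin M by rewrite -eM !inE eqxx.
rewrite /F cardsU1 eM exprS mulN1r mulNr; congr (- (_ * _)).
apply: eq_bigl => x; rewrite /cover big_setU1 //= !inE !negb_or.
by rewrite -!andbA; do 3![case: (_ \in _) || case: (_ == _)]; rewrite /= ?andbF.
Qed.

End Recursion.

(** * Induced subgraphs, disjoint unions and the Rayleigh inequality *)

Lemma setD1C (T : finType) (S : {set T}) u v : S :\ u :\ v = S :\ v :\ u.
Proof. by apply/setP => x; rewrite !inE andbCA. Qed.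

Lemma set_card_ind (T : finType) (P : {set T} -> Prop) :
  (forall S : {set T}, (forall S' : {set T}, (#|S'| < #|S|)%N -> P S') -> P S) ->
  forall S, P S.
Proof.
move=> IH S; have [n] := ubnP #|S|; elim: n S => // n IHn S ltSn.
by apply: IH => S' ltS'; apply: IHn; apply: leq_trans ltS' _.
Qed.

Lemma ltn_cardD1 (T : finType) (S : {set T}) u : u \in S -> (#|S :\ u| < #|S|)%N.
Proof. by move=> uS; rewrite [ltnRHS](cardsD1 u) uS. Qed.

Lemma ltn_cardD2 (T : finType) (S : {set T}) u v :
  u \in S -> (#|S :\ u :\ v| < #|S|)%N.
Proof.
move=> uS; apply: leq_ltn_trans (ltn_cardD1 uS).
by rewrite subset_leq_card // subsetDl.
Qed.

Section Weighted.
Variables (A : comNzRingType).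

Lemma eq_wmu (G : sgraph) (w w' : G -> A) (S : {set G}) :
  {in S, w =1 w'} -> wmu w S = wmu w' S.
Proof.
move=> eqw; apply: eq_bigr => M _; congr (_ * _); apply: eq_bigr => v.
by rewrite inE => /andP [_ /eqw].
Qed.

(** Lets graphs induced on a subset, and graphs induced on those in turn, be
    replaced by subsets of one ambient graph. *)
Lemma wmu_embed (H G : sgraph) (f : H -> G) (w : G -> A) (T : {set H}) :
  injective f -> (forall x y, adj (f x) (f y) = adj x y) ->
  wmu (w \o f) T = wmu w (f @: T).
Proof.
move=> f_inj f_adj; elim/set_card_ind: T => T IH.
have [->|[u uT]] := set_0Vmem T; first by rewrite imset0 !wmu0.
have fD (U : {set H}) x : f @: (U :\ x) = f @: U :\ f x.
  apply/setP => y; apply/imsetP/setD1P => [[z /setD1P [zx zU] ->]|].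
    by rewrite (inj_eq f_inj) zx imset_f.
  case=> yx /imsetP [z zU yE]; exists z => //; rewrite !inE zU andbT.
  by apply: contraNneq yx => <-; rewrite yE.
rewrite (wmu_rec _ uT) (@wmu_rec _ _ w _ (f u)) ?imset_f // -fD.
rewrite IH ?ltn_cardD1 //= big_imset_cond /=; last by move=> x y _ _ /f_inj.
congr (_ - _); apply: eq_big => [v|v _]; first by rewrite f_adj.
by rewrite IH ?ltn_cardD2 // fD.
Qed.

Variable G : sgraph.
Implicit Types (S : {set G}).

Lemma wmu_closed (w : G -> A) S (C : {set G}) : closed (@adj G) C ->
  wmu w S = wmu w (S :&: C) * wmu w (S :\: C).
Proof.
move=> cC; elim/set_card_ind: S => S IH.
have [S0|[u]] := set_0Vmem (S :&: C).
  rewrite S0 wmu0 mul1r; congr wmu; apply/setP => x.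
  by move/setP/(_ x): S0; rewrite !inE; case: (x \in S) => [/= ->|]; rewrite ?andbF.
move=> uSC; have /setIP [uS uC] := uSC.
have D1 (U : {set G}) v : (U :\ v) :&: C = (U :&: C) :\ v.
  by apply/setP => x; rewrite !inE andbA.
have D2 (U : {set G}) v : v \in C -> (U :\ v) :\: C = U :\: C.
  move=> vC; apply/setP => x; rewrite !inE.
  by have [->|] := eqVneq x v; rewrite ?vC.
rewrite (wmu_rec _ uS) (wmu_rec _ uSC) mulrBl IH ?ltn_cardD1 // D1 D2 // mulrA.
congr (_ - _); rewrite big_distrl /=; apply: eq_big => [v|v /andP [vS uv]].
  by rewrite !inE -!andbA; case: (boolP (adj u v)) => [/cC <-|];
     rewrite ?uC ?andbF.
by rewrite IH ?ltn_cardD2 // !D1 !D2 // -(cC _ _ uv).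
Qed.

(** The weighted polynomial is affine in each single weight. *)
Lemma wmu_shift (w w' : G -> A) S c : c \in S -> {in S :\ c, w =1 w'} ->
  wmu w' S = wmu w S + (w' c - w c) * wmu w (S :\ c).
Proof.
move=> cS eqw; rewrite !(wmu_rec _ cS) -(eq_wmu eqw).
under [in LHS]eq_bigr => v _.
  rewrite -(@eq_wmu G w w'); last by move=> x /setD1P [_ /eqw].
  over.
by rewrite mulrBl; ring.
Qed.
End Weighted.

Section Rayleigh.
Variables (A : realDomainType) (G : sgraph) (w : G -> A).

(** Expand mu(S) and mu(S-v) at u.  The terms with the weight of u cancel, a
    possible edge uv contributes the square, and each other neighbour i of u
    contributes the same expression for i, v in S-u, which is nonnegative by
    induction. *)
Lemma rayleigh (S : {set G}) u v : u \in S -> v \in S -> u != v ->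
  (adj u v)%:R * wmu w (S :\ u :\ v) ^+ 2 <=
  wmu w (S :\ u) * wmu w (S :\ v) - wmu w S * wmu w (S :\ u :\ v).
Proof.
elim/set_card_ind: S u v => S IH u v uS vS uv.
have vSu : v \in S :\ u by rewrite !inE eq_sym uv.
have uSv : u \in S :\ v by rewrite !inE uv.
rewrite (wmu_rec _ uS) (wmu_rec _ uSv) (setD1C S v u).
set a := wmu w (S :\ u); set b := wmu w (S :\ u :\ v).
rewrite [X in (w u * a - X) * b]big_mkcondr (big_setD1 v) //= -big_mkcondr /=.
have IHi i : (i \in S :\ u :\ v) && adj u i ->
    0 <= wmu w (S :\ u :\ i) * b - a * wmu w (S :\ u :\ v :\ i).
  rewrite !inE -!andbA => /and4P [iv iu iS _].
  rewrite (setD1C _ v); apply: le_trans (IH _ (ltn_cardD1 uS) i v _ _ iv).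
  - by rewrite mulr_ge0 ?ler0n ?sqr_ge0.
  - by rewrite !inE iu iS.
  - by [].
rewrite -subr_ge0.
set t := \sum_(i in _ | _) _; set s := \sum_(i in _ | _) _.
have -> :
  a * (w u * b - t) - (w u * a - ((if adj u v then b else 0) + s)) * b
    - (adj u v)%:R * b ^+ 2 = s * b - a * t.
  by case: (adj u v); rewrite ?mul1r ?mul0r; ring.
rewrite /s /t mulr_suml mulr_sumr -sumrB; exact: sumr_ge0.
Qed.
End Rayleigh.

(** * Orders of vanishing of nonnegative polynomials *)

Section LocalSign.
Variables (R : realFieldType) (theta : R).
Implicit Types (p q g D : {poly R}).

(** One-sided continuity at theta.  The sign s selects the side from which
    theta is approached. *)
Lemma horner_limit_ge0 q s : `|s| = 1 ->
  (forall e, 0 < e -> 0 <= q.[theta + s * e]) -> 0 <= q.[theta].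
Proof.
move=> s1 q_ge0; rewrite leNgt; apply/negP => q_lt0.
have /factor_theorem [r rE] : root (q - q.[theta]%:P) theta.
  by rewrite rootE !hornerE subrr.
have qE x : q.[theta + x] = q.[theta] + r.[theta + x] * x.
  have := congr1 (horner^~ (theta + x)) rE.
  rewrite /= !hornerE => rx; lra.
have [B rB] := poly_disk_bound r (`|theta| + 1).
set a := - q.[theta]; have a_gt0 : 0 < a by rewrite oppr_gt0.
pose b := `|B| + 1; have b_gt0 : 0 < b by rewrite ltr_wpDl.
have ab_gt0 : 0 < a + b by rewrite addr_gt0.
pose e := a / (a + b); have e_gt0 : 0 < e by rewrite divr_gt0.
have e_lt1 : e < 1.
  by rewrite ltr_pdivrMr // mul1r ltrDl.
have := q_ge0 e e_gt0; rewrite qE leNgt; apply/negP; rewrite negbK.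
have rb : `|r.[theta + s * e] * (s * e)| <= b * e.
  rewrite normrM (normrM s) s1 mul1r (gtr0_norm e_gt0).
  apply: ler_wpM2r; first exact: ltW.
  apply: le_trans (rB _ _) _.
    rewrite (le_trans (ler_normD _ _)) // lerD2l (normrM s) s1 mul1r.
    by rewrite gtr0_norm // ltW.
  by rewrite (le_trans (ler_norm B)) // lerDl.
have be : b * e < a.
  rewrite /e mulrA ltr_pdivrMr // mulrDr (mulrC b) ltrDr.
  exact: mulr_gt0.
have := le_lt_trans (le_trans (ler_norm _) rb) be.
by rewrite /a; lra.
Qed.

Lemma nonneg_even_order p q j : (forall x, 0 <= p.[x]) ->
  p = ('X - theta%:P) ^+ j.*2 * q -> 0 <= q.[theta].
Proof.
move=> p_ge0 pE; apply: (@horner_limit_ge0 _ 1) => [|e e_gt0].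
  exact: normr1.
have := p_ge0 (theta + 1 * e); rewrite pE !hornerE addrC addKr ?mul1r.
by rewrite pmulr_rge0 // exprn_gt0.
Qed.

(** A nonnegative polynomial cannot change sign, so an odd power of
    'X - theta never is its exact order of vanishing. *)
Lemma nonneg_odd_order p q j : (forall x, 0 <= p.[x]) ->
  p = ('X - theta%:P) ^+ j.*2.+1 * q -> q.[theta] = 0.
Proof.
move=> p_ge0 pE; apply: le_anti; apply/andP; split; last first.
  apply: (@horner_limit_ge0 _ 1) => [|e e_gt0]; first exact: normr1.
  have := p_ge0 (theta + 1 * e); rewrite pE !hornerE addrC addKr ?mul1r.
  by rewrite pmulr_rge0 // exprn_gt0.
rewrite -oppr_ge0 -hornerN.
apply: (@horner_limit_ge0 _ (-1)) => [|e e_gt0]; first exact: normrN1.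
have := p_ge0 (theta + -1 * e); rewrite pE !hornerE addrC addKr ?mulN1r.
rewrite exprS -mul2n exprM sqrrN -exprM mul2n -mulrA mulNr -mulrN.
by rewrite pmulr_rge0 // -mulrN pmulr_rge0 // exprn_gt0.
Qed.

(** The way in which rayleigh is used: a square bounded by D vanishes to at
    least the order of D, and its own order is even, so that 2j+1 for D forces
    2j+2 for the square. *)
Lemma dvdp_of_sqr_le g D j : (forall x, g.[x] ^+ 2 <= D.[x]) ->
  ('X - theta%:P) ^+ j.*2.+1 %| D -> ('X - theta%:P) ^+ j.+1 %| g.
Proof.
move=> gD /dvdpP [q DE].
suff H i : (i <= j.+1)%N -> ('X - theta%:P) ^+ i %| g by apply: H.
elim: i => [|i IHi] ij; first exact: dvd1p.
have /dvdpP [h hE] := IHi (ltnW ij).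
suff /dvdpP [k kE] : 'X - theta%:P %| h.
  by rewrite hE kE exprS -mulrA dvdp_mull.
rewrite dvdp_XsubCl rootE; apply/eqP.
pose r := ('X - theta%:P) ^+ (j - i).*2.+1 * q - h ^+ 2.
have : 0 <= r.[theta].
  apply: (@nonneg_even_order (D - g ^+ 2) r i) => [x|].
    by rewrite !hornerE subr_ge0.
  rewrite DE hE /r mulrBr mulrA -exprD exprMn -exprM muln2.
  have -> : (i.*2 + (j - i).*2.+1 = j.*2.+1)%N by lia.
  by rewrite [q * _]mulrC [h ^+ 2 * _]mulrC.
rewrite /r !hornerE subrr expr0n /= mul0r sub0r oppr_ge0 => h2.
by apply/eqP; rewrite -sqrf_eq0 eq_le h2 sqr_ge0.
Qed.

End LocalSign.

(** * The matching polynomial in one indeterminate *)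

Definition mu (R : comNzRingType) (G : sgraph) (S : {set G}) : {poly R} :=
  wmu (fun=> 'X) S.
Arguments mu : clear implicits.
Arguments mu R {G} S.

Section MuRing.
Variables (R : comNzRingType) (G : sgraph).
Implicit Types (S : {set G}).

Lemma horner_mu S x : (mu R S).[x] = wmu (fun=> x) S.
Proof.
rewrite horner_sum; apply: eq_bigr => M _.
by rewrite hornerM horner_exp hornerN hornerC horner_prod;
   under eq_bigr do rewrite hornerX.
Qed.

Lemma mu_rec S u : u \in S ->
  mu R S = 'X * mu R (S :\ u) - \sum_(v in S :\ u | adj u v) mu R (S :\ u :\ v).
Proof. exact: wmu_rec. Qed.

(** Differentiating 'X^n removes one unmatched vertex in each of n ways. *)
Lemma deriv_mu S : (mu R S)^`() = \sum_(v in S) mu R (S :\ v).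
Proof.
rewrite /mu /wmu (exchange_big_dep (matching_in S)) /=; last first.
  by move=> v M _; rewrite -matching_in_notin => /andP [].
rewrite raddf_sum /=; apply: eq_bigr => M SM.
rewrite [RHS](eq_bigl (mem (S :\: cover M))); last first.
  by move=> v /=; rewrite -matching_in_notin SM !inE andbC.
have -> : (-1) ^+ #|M| = ((-1) ^+ #|M|)%:P :> {poly R}.
  by rewrite polyC_exp polyCN.
rewrite prodr_const deriv_mulC derivXn.
rewrite (eq_bigr (fun=> ((-1) ^+ #|M|)%:P * 'X^(#|S :\: cover M|.-1))).
  by rewrite sumr_const -mulrnAr.
move=> v vSM; rewrite prodr_const; congr (_ * 'X^_).
rewrite (cardsD1 v (S :\: cover M)) (vSM : v \in _) /=; apply: eq_card => x.
by rewrite !inE andbCA.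
Qed.

Lemma monic_size_mu S : mu R S \is monic /\ size (mu R S) = #|S|.+1.
Proof.
elim/set_card_ind: S => S IH; have [->|[u uS]] := set_0Vmem S.
  by rewrite /mu wmu0 cards0 size_poly1 monic1.
have [mon sz] := IH _ (ltn_cardD1 uS).
have szX : size ('X * mu R (S :\ u)) = #|S|.+1.
  by rewrite mulrC size_mulX ?monic_neq0 // sz (cardsD1 u S) uS.
have lt : (size (- \sum_(v in S :\ u | adj u v) mu R (S :\ u :\ v))%R <
           size ('X * mu R (S :\ u))%R)%N.
  rewrite szX size_polyN ltnS; apply: leq_trans (size_sum _ _ _) _.
  apply/bigmax_leqP => v _; have [_ ->] := IH _ (ltn_cardD2 v uS).
  exact: ltn_cardD2.
rewrite (mu_rec uS); split; last by rewrite size_polyDl.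
by rewrite monicE lead_coefDl // mulrC lead_coefMX -monicE.
Qed.

Lemma monic_mu S : mu R S \is monic. Proof. by have [] := monic_size_mu S. Qed.
Lemma mu_neq0 S : mu R S != 0. Proof. exact/monic_neq0/monic_mu. Qed.

End MuRing.

(** * Multiplicities under vertex deletion *)

Lemma dvdp_bigsum (R : fieldType) (I : finType) (P : pred I) (d : {poly R}) F :
  (forall i, P i -> d %| F i) -> d %| \sum_(i | P i) F i.
Proof. by move=> dF; elim/big_ind: _ => // p q; exact: dvdp_add. Qed.

Section Multiplicity.
Variables (R : realFieldType) (theta : R) (G : sgraph).
Implicit Types (S : {set G}).

Local Notation Z := ('X - theta%:P).
Local Notation mu S := (mu R S).
Definition mult_in S := mup theta (mu S).

Lemma deriv_XsubC_exp_mul n (q : {poly R}) :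
  (Z ^+ n * q)^`() = Z ^+ n.-1 *+ n * q + Z ^+ n * q^`().
Proof. by rewrite derivM deriv_exp derivXsubC mul1r. Qed.

Lemma dvdp_deriv_XsubC n (p : {poly R}) : Z ^+ n %| p -> Z ^+ n.-1 %| p^`().
Proof.
move=> /dvdpP [q ->]; rewrite mulrC deriv_XsubC_exp_mul dvdp_add ?dvdp_mulr //.
  by rewrite -mulr_natr dvdp_mulr.
by rewrite dvdp_exp2l ?leq_pred.
Qed.

Lemma mult_in_geq S n : (n <= mult_in S)%N = (Z ^+ n %| mu S).
Proof. exact/mup_geq/mu_neq0. Qed.

Lemma mu_factor_ge S n : (n <= mult_in S)%N -> exists q, mu S = Z ^+ n * q.
Proof. by rewrite mult_in_geq => /dvdpP [q ->]; exists q; rewrite mulrC. Qed.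

Lemma mu_factor S : exists2 q, mu S = Z ^+ (mult_in S) * q & q.[theta] != 0.
Proof.
have [q qE] := mu_factor_ge (leqnn (mult_in S)); exists q => //.
have : ~~ (mult_in S < mult_in S)%N by rewrite ltnn.
apply: contra => q0; rewrite mult_in_geq exprSr qE dvdp_mul // dvdp_XsubCl rootE.
exact: q0.
Qed.

Lemma nonneg_rayleigh S u v x : u \in S -> v \in S -> u != v ->
  0 <= (mu (S :\ u) * mu (S :\ v) - mu S * mu (S :\ u :\ v)).[x].
Proof.
move=> uS vS uv; rewrite !hornerE !horner_mu.
apply: le_trans (rayleigh _ uS vS uv).
by rewrite mulr_ge0 ?ler0n ?sqr_ge0.
Qed.

(** By deriv_mu, the Wronskian mu(S)' mu(S-u) - mu(S) mu(S-u)' is mu(S-u)^2 plus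
    the Rayleigh differences of u with all other vertices, hence at least
    mu(S-u)^2.  If m(S) were larger than j + 1, with j = m(S-u), then the
    Wronskian would vanish to order 2j+1, too high for that square. *)
Lemma mult_in_le_del S u : u \in S -> (mult_in S <= (mult_in (S :\ u)).+1)%N.
Proof.
move=> uS; rewrite leqNgt; apply/negP => lt.
set j := mult_in (S :\ u) in lt.
suff : (j.+1 <= mult_in (S :\ u))%N by rewrite ltnn.
rewrite mult_in_geq.
pose W := (mu S)^`() * mu (S :\ u) - mu S * (mu (S :\ u))^`().
apply: (@dvdp_of_sqr_le _ _ _ W) => [x|].
  rewrite /W !deriv_mu (big_setD1 u) //= !hornerE ![(\sum_(v in _) _).[x]]horner_sum.
  rewrite mulrDl -addrA -expr2 lerDl mulr_suml mulr_sumr -sumrB.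
  apply: sumr_ge0 => v /setD1P [vu vS].
  rewrite [X in 0 <= X - _]mulrC -!hornerM -hornerN -hornerD.
  by apply: nonneg_rayleigh; rewrite // eq_sym.
have dS : Z ^+ j.+2 %| mu S by rewrite -mult_in_geq.
have du : Z ^+ j %| mu (S :\ u) by rewrite -mult_in_geq.
rewrite -addnn -addSn; apply: dvdp_sub.
  by rewrite exprD dvdp_mul // (dvdp_deriv_XsubC dS).
apply: dvdp_trans (dvdp_mul dS (dvdp_deriv_XsubC du)).
by rewrite -exprD dvdp_exp2l //; lia.
Qed.

(** In the expansion of mu(S) at u every term vanishes to order m(S-u) - 1, by
    mult_in_le_del applied to S-u. *)
Lemma mult_in_del_le S u : u \in S -> (mult_in (S :\ u) <= (mult_in S).+1)%N.
Proof.
move=> uS; case E: (mult_in (S :\ u)) => [//|j]; rewrite ltnS mult_in_geq (mu_rec _ uS).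
apply: dvdp_sub; first by rewrite dvdp_mull // -mult_in_geq E.
apply: dvdp_bigsum => v /andP [vS _].
by have := mult_in_le_del vS; rewrite E -mult_in_geq ltnS.
Qed.

Lemma sqr_le_rayleigh S u v x : u \in S -> v \in S -> adj u v ->
  (mu (S :\ u :\ v)).[x] ^+ 2 <=
  (mu (S :\ u) * mu (S :\ v) - mu S * mu (S :\ u :\ v)).[x].
Proof.
move=> uS vS uv; rewrite !hornerE !horner_mu.
by have := rayleigh (fun=> x) uS vS (adj_neq uv); rewrite uv mul1r.
Qed.

Definition essential_in S u := (mult_in (S :\ u)).+1 == mult_in S.

(** With l = m(S-v), the product mu(S-u) mu(S-v) has the odd order 2l+1.  If u
    and v were adjacent, then rayleigh would first force m(S-u-v) > l; then
    mu(S) mu(S-u-v) has order at least 2l+2, and the nonnegative Rayleigh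
    difference would have the odd exact order 2l+1. *)
Lemma neutral_essential_nonadj S u v : u \in S -> v \in S ->
  mult_in (S :\ u) = mult_in S -> essential_in S v -> ~~ adj u v.
Proof.
move=> uS vS mu_u /eqP mu_v; apply/negP => uv; set l := mult_in (S :\ v) in mu_v.
have [f fE f0] := mu_factor (S :\ u); rewrite mu_u -mu_v in fE.
have [g gE g0] := mu_factor (S :\ v); rewrite -/l in gE.
have [h hE] := mu_factor_ge (leqnn (mult_in S)); rewrite -mu_v in hE.
have vSu : v \in S :\ u by rewrite !inE vS eq_sym adj_neq.
have := mult_in_le_del vSu; rewrite mu_u -mu_v ltnS => le_l.
have [k kE] := mu_factor_ge le_l.
(* the order of a square is even, so l improves to l + 1 *)
have lt_l : (l < mult_in (S :\ u :\ v))%N.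
  rewrite mult_in_geq; apply: dvdp_of_sqr_le (fun x => sqr_le_rayleigh x uS vS uv) _.
  rewrite fE gE hE kE -addnn -addSn exprD.
  by apply: dvdp_sub; rewrite mulrACA dvdp_mulr.
have [{}k {}kE] := mu_factor_ge lt_l.
pose q := f * g - Z * h * k.
suff : q.[theta] = 0.
  by apply/eqP; rewrite !hornerE subrr !mul0r subr0 mulf_neq0.
apply: (@nonneg_odd_order _ _ _ q l
          (fun x => nonneg_rayleigh x uS vS (adj_neq uv))).
rewrite fE gE hE kE /q -addnn -addSn exprD !exprS.
by clearbody l; move: (Z ^+ l) (Z) => zl z; ring.
Qed.

(** The Rayleigh difference vanishes to order 2 m(S) - 2, so its lower bound
    mu(S-u-v)^2 does as well. *)
Lemma adj_essential_parallel S u v : u \in S -> v \in S -> adj u v ->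
  essential_in S u -> essential_in S v -> (mult_in S <= (mult_in (S :\ u :\ v)).+1)%N.
Proof.
move=> uS vS uv /eqP mu_u /eqP mu_v.
have muv : mult_in (S :\ v) = mult_in (S :\ u) by apply: succn_inj; rewrite mu_u.
case E : (mult_in (S :\ u)) => [|j]; first by rewrite -mu_u E.
rewrite -mu_u E ltnS mult_in_geq.
apply: dvdp_of_sqr_le (fun x => sqr_le_rayleigh x uS vS uv) _.
have vSu : v \in S :\ u by rewrite !inE vS eq_sym adj_neq.
have [f ->] : exists f, mu (S :\ u) = Z ^+ j.+1 * f by apply: mu_factor_ge; rewrite E.
have [g ->] : exists g, mu (S :\ v) = Z ^+ j.+1 * g.
  by apply: mu_factor_ge; rewrite muv E.
have [h ->] : exists h, mu S = Z ^+ j.+2 * h by apply: mu_factor_ge; rewrite -mu_u E.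
have [k ->] : exists k, mu (S :\ u :\ v) = Z ^+ j * k.
  by apply: mu_factor_ge; have := mult_in_le_del vSu; rewrite E.
apply: dvdp_sub; rewrite mulrACA -exprD dvdp_mulr // dvdp_exp2l //; lia.
Qed.

(** The Rayleigh inequality for a, b at the point x, where c has the weight
    x + lam (x - theta) and all other vertices have the weight x. *)
Lemma shifted_rayleigh S a b c (lam : R) x :
  a \in S -> b \in S -> c \in S -> a != b -> a != c -> b != c ->
  0 <= ((mu (S :\ a) + lam *: Z * mu (S :\ a :\ c)) *
        (mu (S :\ b) + lam *: Z * mu (S :\ b :\ c)) -
        (mu S + lam *: Z * mu (S :\ c)) *
        (mu (S :\ a :\ b) + lam *: Z * mu (S :\ a :\ b :\ c))).[x].
Proof.
move=> aS bS cS ab ac bc.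
pose w v := if v == c then x + lam * (x - theta) else x.
have wE (T : {set G}) : c \in T -> (mu T + lam *: Z * mu (T :\ c)).[x] = wmu w T.
  move=> cT; rewrite (@wmu_shift _ _ (fun=> x) w T c) //.
    by rewrite !hornerE !horner_mu /w eqxx [x + _]addrC addrK.
  by move=> v /setD1P [vc _]; rewrite /w (negPf vc).
rewrite hornerD hornerN !hornerM.
rewrite !wE ?inE // ?[c == _]eq_sym ?ab ?ac ?bc //.
apply: le_trans (rayleigh w aS bS ab).
by rewrite mulr_ge0 ?ler0n ?sqr_ge0.
Qed.

(** Suppose that a and c are not parallel and set i = m(S-a-c) = m(S) - 2.  In
    the shifted inequality the subtracted product vanishes to order 2i+3, while
    the first product has the coefficient fb (fa + lam fac) at order 2i+2, where fa, fb and fac are the lowest coefficients of mu(S-a), mu(S-b)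
    and mu(S-a-c).  As fb and fac are nonzero, some lam makes it negative. *)
Lemma parallel_trans S a b c : a \in S -> b \in S -> c \in S ->
  a != b -> a != c -> b != c ->
  essential_in S a -> essential_in S b -> essential_in S c ->
  (mult_in S <= (mult_in (S :\ a :\ b)).+1)%N ->
  (mult_in S <= (mult_in (S :\ b :\ c)).+1)%N ->
  (mult_in S <= (mult_in (S :\ a :\ c)).+1)%N.
Proof.
move=> aS bS cS ab ac bc /eqP Ea /eqP Eb /eqP Ec Hab Hbc.
rewrite leqNgt; apply/negP => Hac.
have caS : c \in S :\ a by rewrite !inE cS eq_sym ac.
have cabS : c \in S :\ a :\ b by rewrite !inE cS ![c == _]eq_sym bc ac.
have Hac' := mult_in_le_del caS; have Habc := mult_in_le_del cabS.
pose i := mult_in (S :\ a :\ c); rewrite -/i in Hac Hac'.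
have mSE : mult_in S = i.+2.
  by apply/eqP; rewrite eqn_leq Hac andbT -Ea ltnS.
rewrite mSE in Ea Eb Ec Hab Hbc; case: Ea Eb Ec => Ea [Eb] [Ec].
rewrite ltnS in Hab; rewrite ltnS in Hbc.
have [h hE] : exists h, mu S = Z ^+ i.+2 * h.
  by apply: mu_factor_ge; rewrite mSE.
have [fa faE] : exists f, mu (S :\ a) = Z ^+ i.+1 * f.
  by apply: mu_factor_ge; rewrite Ea.
have [fb fbE fb0] := mu_factor (S :\ b); rewrite Eb in fbE.
have [fc fcE] : exists f, mu (S :\ c) = Z ^+ i.+1 * f.
  by apply: mu_factor_ge; rewrite Ec.
have [fab fabE] : exists f, mu (S :\ a :\ b) = Z ^+ i.+1 * f.
  exact: mu_factor_ge.
have [fbc fbcE] : exists f, mu (S :\ b :\ c) = Z ^+ i.+1 * f.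
  exact: mu_factor_ge.
have [fac facE fac0] := mu_factor (S :\ a :\ c); rewrite -/i in facE.
have [fabc fabcE] : exists f, mu (S :\ a :\ b :\ c) = Z ^+ i * f.
  by apply: mu_factor_ge; exact: leq_trans Hab Habc.
(* chosen so that the lowest coefficient becomes the negative of fb squared *)
pose lam := - (fa.[theta] + fb.[theta]) / fac.[theta].
pose q := (fa + lam *: fac) * (fb + lam *: Z * fbc)
          - Z * (h + lam *: fc) * (fab + lam *: fabc).
have : 0 <= q.[theta].
  apply: (@nonneg_even_order _ _ _ q i.+1
            (fun x => shifted_rayleigh lam x aS bS cS ab ac bc)).
  rewrite hE faE fbE fcE fabE fbcE facE fabcE /q -addnn exprD !exprS -!mul_polyC.
  by clearbody i lam; move: (Z ^+ i) (Z) (lam%:P) => zi z l; ring.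
have -> : q.[theta] = - fb.[theta] ^+ 2.
  rewrite /q !hornerE subrr /lam !(mulr0, mul0r, subr0, addr0).
  by field.
by rewrite oppr_ge0 leNgt exprn_even_gt0 ?fb0.
Qed.

(** Otherwise every mu(S-u), hence the derivative of mu(S), would vanish at
    theta to the order of mu(S) itself. *)
Lemma essential_exists S : (0 < mult_in S)%N -> exists2 u, u \in S & essential_in S u.
Proof.
move=> m0; have [/exists_inP //|none] := boolP [exists u in S, essential_in S u].
have dv : Z ^+ (mult_in S) %| (mu S)^`().
  rewrite deriv_mu; apply: dvdp_bigsum => u uS.
  move: none; rewrite negb_exists => /forallP /(_ u); rewrite uS /=.
  rewrite /essential_in -mult_in_geq => ne; have := mult_in_le_del uS; move: ne; lia.
have [q qE q0] := mu_factor S.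
case E: (mult_in S) m0 => [//|l] _; rewrite E in dv qE.
move: dv; rewrite qE deriv_XsubC_exp_mul /=.
have -> : Z ^+ l *+ l.+1 * q + Z ^+ l.+1 * q^`() = Z ^+ l * (q *+ l.+1 + Z * q^`()).
  by rewrite exprSr; move: (Z ^+ l) (Z) => zl z; ring.
rewrite exprSr dvdp_mul2l ?expf_neq0 ?polyXsubC_eq0 // dvdp_XsubCl rootE.
by rewrite hornerD hornerM hornerXsubC subrr mul0r addr0 hornerMn mulrn_eq0 (negPf q0).
Qed.

End Multiplicity.

(** * Components and critical graphs *)

Section Bridge.

Lemma card_cover_matching (G : sgraph) (S : {set G}) M :
  matching_in S M -> #|cover M| = #|M|.*2.
Proof.
case/and3P => /subsetP Me Mt _.
have := (leq_card_cover M).2; rewrite Mt => /eqP ->.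
rewrite -muln2 -sum_nat_const; apply: eq_bigr => e /Me /edgesP [x [y [xy ->]]].
by rewrite cards2 adj_neq.
Qed.

Lemma matching_poly_mu (R : realType) (G : sgraph) :
  matching_poly R G = mu R [set: G].
Proof.
have half_bound M : matching_in [set: G] M -> (#|M| < (#|G|./2).+1)%N.
  move=> SM; rewrite ltnS -(doubleK #|M|) -(card_cover_matching SM).
  by rewrite half_leq // max_card.
(* inord loses nothing here, by half_bound *)
pose r (M : {set {set G}}) : 'I_(#|G|./2).+1 := inord #|M|.
rewrite /mu /wmu (partition_big r predT) //=; apply: eq_bigr => k _.
rewrite (eq_bigl (mem (matchings G k))); last first.
  move=> M; rewrite !inE; apply/andP/and3P => [[SM /eqP <-]|[Me Mt /eqP Mk]].
    by have /and3P [-> -> _] := SM; rewrite inordK ?half_bound.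
  have SM : matching_in [set: G] M by rewrite /matching_in Me Mt subsetT.
  by split=> //; apply/eqP/val_inj; rewrite /= inordK ?half_bound.
rewrite (eq_bigr (fun=> (-1) ^+ k *: 'X^(#|G| - k.*2))); last first.
  move=> M; rewrite !inE => /and3P [Me Mt /eqP Mk].
  have SM : matching_in [set: G] M by rewrite /matching_in Me Mt subsetT.
  rewrite prodr_const Mk -mul_polyC polyC_exp polyCN.
  by rewrite setTD cardsCs setCK (card_cover_matching SM) Mk.
by rewrite sumr_const scalerMnl mulr_natr.
Qed.

Variables (R : realType) (theta : R).

Lemma mult_in_embed (H G : sgraph) (f : H -> G) (T : {set H}) :
  injective f -> (forall x y, adj (f x) (f y) = adj x y) ->
  mult_in theta T = mult_in theta (f @: T).
Proof. by move=> f_inj f_adj; rewrite /mult_in /mu -wmu_embed. Qed.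

Lemma multE (G : sgraph) : mult theta G = mult_in theta [set: G].
Proof. by rewrite /mult matching_poly_mu. Qed.

Lemma val_induced_setT (G : sgraph) (S : {set G}) : val @: [set: induced S] = S.
Proof.
apply/setP => x; apply/imsetP/idP => [[y _ ->]|xS]; first exact: valP.
by exists (exist _ x xS).
Qed.

Lemma mult_in_induced (G : sgraph) (S : {set G}) (T : {set induced S}) :
  mult_in theta T = mult_in theta (val @: T).
Proof. by apply: (@mult_in_embed (induced S) G val) => //; exact: val_inj. Qed.

Lemma mult_induced (G : sgraph) (S : {set G}) : mult theta (induced S) = mult_in theta S.
Proof. by rewrite multE mult_in_induced val_induced_setT. Qed.

Lemma val_induced_setD1 (G : sgraph) (S : {set G}) (u : induced S) :
  val @: ([set: induced S] :\ u) = S :\ val u.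
Proof.
apply/setP => x; rewrite in_setD1; apply/imsetP/idP.
  case=> y /setD1P [yu _] ->; rewrite (valP y) andbT.
  by apply: contraNneq yu => eq_yu; apply/eqP; exact: val_inj.
case/andP => xu xS; exists (exist _ x xS) => //.
by rewrite !inE andbT; apply: contraNneq xu => <-.
Qed.

Lemma mult_del1 (H : sgraph) (u : H) :
  mult theta (del [set u]) = mult_in theta ([set: H] :\ u).
Proof. by rewrite mult_induced setTD. Qed.

Variable G : sgraph.
Implicit Types (S C X : {set G}).

Lemma criticalE C : critical theta (induced C) =
  [forall u in C, essential_in theta C u] && (mult_in theta C == 1%N).
Proof.
rewrite /critical mult_induced; congr (_ && _).
have essE (u : induced C) :
    essential theta u = essential_in theta C (val u).
  by rewrite /essential mult_del1 mult_induced mult_in_induced val_induced_setD1.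
apply/forallP/forall_inP => [ess u uC|ess u]; last by rewrite essE; exact/ess/valP.
by have := ess (exist _ u uC); rewrite essE.
Qed.

Lemma mult_in_closed S C : closed (@adj G) C ->
  mult_in theta S = (mult_in theta (S :&: C) + mult_in theta (S :\: C))%N.
Proof.
by move=> cC; rewrite /mult_in /mu (wmu_closed _ _ cC) mupM ?mu_neq0.
Qed.

Lemma mult_in_cover (P : {set {set G}}) : trivIset P ->
  {in P, forall C, closed (@adj G) C} ->
  mult_in theta (cover P) = (\sum_(C in P) mult_in theta C)%N.
Proof.
elim/set_card_ind: P => P IH tP cP; have [->|[C CP]] := set_0Vmem P.
  by rewrite /cover !big_set0 /mult_in /mu wmu0 mupNroot // root1.
rewrite (mult_in_closed _ (cP _ CP)) (big_setD1 C) //= -coverD1 //.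
have -> : cover P :&: C = C by apply/setIidPr/bigcup_sup.
congr (_ + _)%N; apply: IH; first exact: ltn_cardD1.
  exact: trivIsetS (subsetDl _ _) tP.
by move=> D /setD1P [_ /cP].
Qed.

Lemma adj_connect_sym : connect_sym (@adj G).
Proof. exact/sym_connect_sym/adj_sym. Qed.

Lemma components_partition : partition (components G) [set: G].
Proof.
apply: equivalence_partitionP => x y z _ _ _; split; first exact: connect0.
by move=> xy; apply: same_connect => //; exact: adj_connect_sym.
Qed.

Lemma component_connect C x y : C \in components G -> x \in C ->
  (y \in C) = connect (@adj G) x y.
Proof.
case/imsetP => z _ ->; rewrite !inE /= => zx.
exact: (same_connect adj_connect_sym zx).
Qed.

Lemma component_closed C : C \in components G -> closed (@adj G) C.
Proof.
move=> CG; apply: (intro_closed adj_connect_sym) => x y xy xC.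
by rewrite (component_connect _ CG xC) connect1.
Qed.

Lemma mult_in_components :
  mult_in theta [set: G] = (\sum_(C in components G) mult_in theta C)%N.
Proof.
have /and3P [/eqP <- tG _] := components_partition.
by apply: mult_in_cover => // C; exact: component_closed.
Qed.

Lemma component_ind C (Q : pred G) u : C \in components G -> u \in C -> Q u ->
  (forall x y, x \in C -> y \in C -> adj x y -> Q x -> Q y) ->
  forall x, x \in C -> Q x.
Proof.
move=> CG uC Qu step x xC.
have cl : closed (@adj G) [set z in C | Q z].
  apply: (intro_closed adj_connect_sym) => y z yz.
  rewrite !inE => /andP [yC Qy].
  by have zC : z \in C; [rewrite -(component_closed CG yz) | rewrite zC (step y z)].
have := closed_connect cl; rewrite (component_connect x CG uC) in xC.
by move/(_ _ _ xC); rewrite !inE uC Qu => /esym /andP [].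
Qed.

(** By connectedness a fixed essential vertex u is parallel to all others.  If
    m(C) were at least two, then C-u would have an essential vertex w, and
    m(C-u-w) = m(C) - 2 says that w is not parallel to u. *)
Lemma gallai C : C \in components G -> (0 < mult_in theta C)%N ->
  {in C, forall u, essential_in theta C u} -> mult_in theta C = 1%N.
Proof.
move=> CG C0 ess; have [u uC _] := essential_exists C0.
have par w : w \in C ->
    (w == u) || (mult_in theta C <= (mult_in theta (C :\ u :\ w)).+1)%N.
  pose Q x := (x == u) || (mult_in theta C <= (mult_in theta (C :\ u :\ x)).+1)%N.
  apply: (@component_ind _ Q u CG uC); rewrite /Q => {w Q}; first by rewrite eqxx.
  move=> x y xC yC xy; have [//|yu] := eqVneq y u.
  have [xu _|xu /=] := eqVneq x u.
    by apply: adj_essential_parallel; rewrite ?ess // -xu.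
  move=> ux; apply: (parallel_trans _ xC) => //; rewrite ?ess // ?[u == _]eq_sym //.
    exact: adj_neq.
  by apply: adj_essential_parallel; rewrite ?ess.
have /eqP uE := ess u uC.
case E : (mult_in theta (C :\ u)) => [|k]; first by rewrite -uE E.
have [|w] := @essential_exists _ theta G (C :\ u); first by rewrite E.
case/setD1P => wu wC /eqP wE; have := par w wC; rewrite (negPf wu) /=.
by rewrite -uE -wE ltnn.
Qed.

(** If no deletion raises the multiplicity, a component contributes one or zero
    according to whether it is critical: essential vertices spread along edges,
    since a neighbour of one is neither neutral nor positive. *)
Lemma component_critical C : C \in components G ->
  (forall u, (mult_in theta ([set: G] :\ u) <= mult_in theta [set: G])%N) ->
  mult_in theta C = critical theta (induced C).
Proof.
move=> CG nopos; rewrite criticalE.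
have noposC u : u \in C -> (mult_in theta (C :\ u) <= mult_in theta C)%N.
  move=> uC; have := nopos u; have cC := component_closed CG.
  rewrite (mult_in_closed _ cC) (mult_in_closed [set: G] cC) setTI.
  have -> : ([set: G] :\ u) :&: C = C :\ u.
    by apply/setP => x; rewrite !inE andbT.
  have -> : ([set: G] :\ u) :\: C = [set: G] :\: C.
    by apply/setP => x; rewrite !inE; case: eqVneq => // ->; rewrite uC.
  by rewrite leq_add2r.
case E : (mult_in theta C) => [|k]; first by rewrite andbF.
have [u uC ess_u] : exists2 u, u \in C & essential_in theta C u.
  by apply: essential_exists; rewrite E.
have ess : {in C, forall x, essential_in theta C x}.
  apply: (@component_ind _ (essential_in theta C) u CG uC ess_u) => x y xC yC xy ess_x.
  have ne : mult_in theta (C :\ y) <> mult_in theta C.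
    move=> neutral; have := neutral_essential_nonadj yC xC neutral ess_x.
    by rewrite adj_sym xy.
  have := noposC y yC; have := mult_in_le_del theta yC; rewrite /essential_in; lia.
by rewrite -E gallai ?E //= andbT; have /forall_inP -> := ess.
Qed.

Lemma nb_criticalE : nb_critical_components theta G =
  (\sum_(C in components G) critical theta (induced C))%N.
Proof.
rewrite /nb_critical_components -sum1_card big_mkcond [RHS]big_mkcond /=.
by apply: eq_bigr => C _; rewrite inE; case: (C \in _); case: critical.
Qed.

Lemma nb_critical_le : (nb_critical_components theta G <= mult theta G)%N.
Proof.
rewrite nb_criticalE multE mult_in_components; apply: leq_sum => C _.
by rewrite criticalE; case: andP => // [[_ /eqP ->]].
Qed.

Lemma mult_in_setD_le S X : (mult_in theta (S :\: X) <= mult_in theta S + #|X|)%N.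
Proof.
elim/set_card_ind: X => X IH; have [->|[u uX]] := set_0Vmem X.
  by rewrite setD0 leq_addr.
have := IH _ (ltn_cardD1 uX); rewrite [#|X|](cardsD1 u) uX addnS /= => IHu.
have XE : S :\: X = (S :\: (X :\ u)) :\ u.
  apply/setP => x; rewrite !inE negb_and negbK.
  by have [->|] := eqVneq x u; rewrite ?uX.
rewrite XE; have [uS|uS] := boolP (u \in S :\: (X :\ u)).
  by have := mult_in_del_le theta uS; move: IHu; lia.
rewrite (_ : _ :\ u = S :\: (X :\ u)); first by move: IHu; lia.
by apply/setP => x; rewrite in_setD1; have [->|] := eqVneq x u; rewrite ?(negPf uS).
Qed.

End Bridge.

Theorem theorem2p1 (R : realType) (theta : R) (G : sgraph) :
  (exists X : {set G},
     (mult theta G)%:Z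
     = (nb_critical_components theta (del X))%:Z - (#|X|)%:Z)
  /\ (forall X : {set G},
        (nb_critical_components theta (del X))%:Z - (#|X|)%:Z
        <= (mult theta G)%:Z).
Proof.
split; last first.
  move=> X; have := nb_critical_le theta (del X).
  rewrite mult_induced -setTD => le1; have := mult_in_setD_le theta [set: G] X.
  rewrite -multE; lia.
pose P (X : {set G}) := mult_in theta (~: X) == (mult_in theta [set: G] + #|X|)%N.
have P0 : P set0 by rewrite /P setC0 cards0 addn0.
case: (@arg_maxnP _ set0 P (fun X => #|X|) P0) => X /eqP PX maxX; exists X.
suff -> : nb_critical_components theta (del X) = mult theta (del X).
  by rewrite mult_induced multE PX; lia.
rewrite nb_criticalE multE mult_in_components; apply: eq_bigr => C CX.
apply/esym/component_critical => // u.
rewrite !mult_in_induced val_induced_setT val_induced_setD1 leqNgt; apply/negP => lt.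
have uX : val u \notin X by have := valP u; rewrite inE.
(* otherwise u could be added to X, against its maximality *)
suff /maxX : P (val u |: X) by rewrite /= cardsU1 uX ltnn.
have XE : ~: X :\ val u = ~: (val u |: X).
  by apply/setP => x; rewrite !inE negb_or.
have uS : val u \in ~: X by rewrite inE.
have := mult_in_del_le theta uS; rewrite /P cardsU1 uX -XE; lia.
Qed.
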